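(* For every $Q>0$ and every $\lambda\in\mathbb{C}\setminus(-2,2)$ satisfying $|\lambda^2-4|=Q^2$, there exists a complex sequence $\upsilon\in\ell^1(\mathbb{Z})$ such that $\|\upsilon\|_{\ell^1(\mathbb{Z})}=Q$ and $\lambda$ is an eigenvalue of the corresponding discrete Schrödinger operator $H_V=H_0+V$ on $\ell^2(\mathbb{Z})$.
   Context: $\{e_n\}_{n\in\mathbb{Z}}$ is the standard basis of the complex Hilbert space $\ell^2(\mathbb{Z})$. The discrete Laplacian $H_0$ is the bounded operator on $\ell^2(\mathbb{Z})$ determined by $H_0e_n=e_{n-1}+e_{n+1}$ for all $n\in\mathbb{Z}$. For a bounded complex sequence $\upsilon=\{\upsilon_n\}_{n\in\mathbb{Z}}$, the potential $V$ is the diagonal operator $Ve_n=\upsilon_ne_n$, $n\in\mathbb{Z}$, and $H_V:=H_0+V$. Eigenvalues are understood with nonzero eigenvectors in $\ell^2(\mathbb{Z})$. $(-2,2)$ denotes the open real interval, regarded as a subset of $\mathbb{C}$. *)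

(* Defs.v *)
From HB Require Import structures.
From mathcomp Require Import all_boot all_order all_algebra.
From mathcomp Require Import all_classical all_reals all_analysis.
From mathcomp Require Import complex lra.

Set Implicit Arguments.
Unset Strict Implicit.
Unset Printing Implicit Defensive.
Import Order.TTheory GRing.Theory Num.Theory.
Import ComplexField.Normc.

Local Open Scope classical_set_scope.
Local Open Scope ring_scope.
Local Open Scope complex_scope.

(* [normc z : R] is the modulus of [z : R[i]] as a real number, whereas
   [`|z|] is [(normc z)%:C : R[i]]. Sequences take values in [R[i]^o], which is R[i]
   regarded as a vector space over itself, so that [int -> R[i]^o] is a complex
   vector space under pointwise operations. *)

Lemma normc_ge0 (R : realType) (z : R[i]) : 0 <= normc z.
Proof. by case: z => a b; rewrite sqrtr_ge0. Qed.

Definition l1sum (R : realType) (u : int -> R[i]^o) : \bar R :=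
  \esum_(n in [set: int]) (normc (u n))%:E.

Definition l2sum (R : realType) (u : int -> R[i]^o) : \bar R :=
  \esum_(n in [set: int]) (normc (u n) ^+ 2)%:E.

Lemma l1sum_ge0 (R : realType) (u : int -> R[i]^o) : (0 <= l1sum u)%E.
Proof. by apply: esum_ge0 => n _; rewrite lee_fin normc_ge0. Qed.

Lemma l2sum_ge0 (R : realType) (u : int -> R[i]^o) : (0 <= l2sum u)%E.
Proof. by apply: esum_ge0 => n _; rewrite lee_fin sqr_ge0. Qed.

Lemma l2sum_dom (R : realType) (c : R) (u v : int -> R[i]^o) : 0 <= c ->
  (forall n, normc (v n) ^+ 2 <= c * normc (u n) ^+ 2) ->
  (l2sum v <= c%:E * l2sum u)%E.
Proof.
move=> c0 cuv; apply: ge_ereal_sup => _ [F [finF _] <-].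
apply: (@le_trans _ _ (\sum_(n \in F) (c%:E * (normc (u n) ^+ 2)%:E))%E).
  by apply: lee_fsum => // n _; rewrite -EFinM lee_fin.
rewrite -ge0_mule_fsumr; last by move=> n; rewrite lee_fin sqr_ge0.
rewrite lee_wpmul2l ?lee_fin//; apply: ereal_sup_ubound.
by exists F => //; split.
Qed.

Lemma l2sumD (R : realType) (u v : int -> R[i]^o) :
  (l2sum (fun n => (u n + v n)%R) <= 2%:E * l2sum u + 2%:E * l2sum v)%E.
Proof.
have sq (a b c : R) : 0 <= a -> 0 <= b -> 0 <= c -> c <= a + b ->
    c ^+ 2 <= 2 * a ^+ 2 + 2 * b ^+ 2.
  move=> a0 b0 c0 cab; apply: (@le_trans _ _ ((a + b) ^+ 2)).
    by rewrite lerXn2r// nnegrE ?addr_ge0.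
  rewrite -subr_ge0 (_ : _ - _ = (a - b) ^+ 2) ?sqr_ge0//.
  by rewrite sqrrD sqrrB; lra.
have scale (w : int -> R[i]^o) :
    (\esum_(n in [set: int]) (2 * normc (w n) ^+ 2)%:E <= 2%:E * l2sum w)%E.
  apply: ge_ereal_sup => _ [F [finF _] <-].
  rewrite (eq_fsbigr (fun n => (2%:E * (normc (w n) ^+ 2)%:E)%E)); last first.
    by move=> n _; rewrite EFinM.
  rewrite -ge0_mule_fsumr; last by move=> n; rewrite lee_fin sqr_ge0.
  rewrite lee_wpmul2l ?lee_fin//; apply: ereal_sup_ubound.
  by exists F => //; split.
apply: le_trans (leeD (scale u) (scale v)).
rewrite -esumD; [|by move=> n _; rewrite lee_fin mulr_ge0 ?sqr_ge0 ..].
apply: le_esum => n _; rewrite -EFinD lee_fin.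
by apply: sq; rewrite ?normc_ge0 ?le_normcD.
Qed.

Lemma l2sum_shift (R : realType) (k : int) (u : int -> R[i]^o) :
  l2sum (fun n => u (n + k)) = l2sum u.
Proof.
rewrite /l2sum [RHS](@reindex_esum R _ _ setT setT (fun n => n + k))//.
- split=> //; first by move=> x y _ _; apply: addIr.
  by move=> y _; exists (y - k) => //; rewrite subrK.
Qed.

Definition ell2_pred (R : realType) : {pred (int -> R[i]^o)} :=
  fun u => (l2sum u < +oo)%E.

Lemma ell2_submod_closed (R : realType) : submod_closed (@ell2_pred R).
Proof.
split.
  rewrite /in_mem /= /ell2_pred /l2sum esum1 ?ltry// => n _.
  by rewrite normc0 expr0n.
move=> a u v; rewrite /in_mem /= /ell2_pred => u2 v2.
have au2 : (l2sum (fun n => (a * (u n : R[i]))%R) < +oo)%E.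
  apply: (@le_lt_trans _ _ ((normc a ^+ 2)%:E * l2sum u)%E).
    by apply: l2sum_dom => [|n]; rewrite ?sqr_ge0// normcM exprMn.
  by rewrite lte_mul_pinfty ?lee_fin ?sqr_ge0.
apply: le_lt_trans (l2sumD _ _) _.
by rewrite lte_add_pinfty// lte_mul_pinfty// lee_fin.
Qed.

HB.instance Definition _ (R : realType) :=
  GRing.isSubmodClosed.Build R[i] (int -> R[i]^o) (@ell2_pred R)
    (ell2_submod_closed R).

Record ell2 (R : realType) := Ell2 {
  ell2_val :> int -> R[i]^o ;
  ell2_valP : ell2_val \in @ell2_pred R }.

HB.instance Definition _ (R : realType) := [isSub for @ell2_val R].
HB.instance Definition _ (R : realType) := [Choice of ell2 R by <:].
HB.instance Definition _ (R : realType) :=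
  [SubChoice_isSubLmodule of ell2 R by <:].

(* [l2sum psi] is finite for [psi : ell2 R], so [fine] loses nothing here. *)
Definition ell2norm (R : realType) (psi : ell2 R) : R :=
  Num.sqrt (fine (l2sum psi)).

Definition bounded_operator (R : realType) (T : ell2 R -> ell2 R) :=
  exists M : R, forall psi, ell2norm (T psi) <= M * ell2norm psi.

Definition ell2_eigenvalue (R : realType) (T : ell2 R -> ell2 R) (lambda : R[i]) :=
  exists2 psi : ell2 R, psi != 0 & T psi = lambda *: psi.

Lemma ell2P (R : realType) (u v : ell2 R) : (forall n, u n = v n) -> u = v.
Proof. by move=> uv; apply: val_inj; apply/funext. Qed.

Lemma ell2norm_dom (R : realType) (c : R) (u v : ell2 R) : 0 <= c ->
  (l2sum v <= (c ^+ 2)%:E * l2sum u)%E -> ell2norm v <= c * ell2norm u.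
Proof.
move=> c0; have uf : l2sum u \is a fin_num.
  by rewrite ge0_fin_numE ?l2sum_ge0//; exact: ell2_valP.
have vf : l2sum v \is a fin_num.
  by rewrite ge0_fin_numE ?l2sum_ge0//; exact: ell2_valP.
rewrite -(fineK uf) -(fineK vf) -EFinM lee_fin => uv.
rewrite /ell2norm -[X in X * _](ger0_norm c0) -sqrtr_sqr -sqrtrM ?sqr_ge0//.
exact: ler_wsqrtr.
Qed.

Lemma basis_ell2 (R : realType) (n : int) :
  (fun m => (m == n)%:R) \in @ell2_pred R.
Proof.
rewrite /in_mem /= /ell2_pred /l2sum (esumID [set n])// ?setTI; last first.
  by move=> m _; rewrite lee_fin sqr_ge0.
rewrite esum_set1 ?lee_fin ?sqr_ge0// esum1 ?adde0 ?ltry// => m /= mn.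
by rewrite (introF eqP mn) normc0 expr0n.
Qed.

Definition ell2_basis (R : realType) (n : int) : ell2 R := Ell2 (basis_ell2 R n).

Lemma laplacian_l2sum (R : realType) (psi : int -> R[i]^o) :
  (l2sum (fun n => (psi (n - 1) + psi (n + 1))%R) <= 4%:E * l2sum psi)%E.
Proof.
apply: le_trans (l2sumD _ _) _.
rewrite !(@l2sum_shift R _ psi) -ge0_muleDl ?lee_fin// -EFinD.
by rewrite (_ : 2 + 2 = 4 :> R)//; lra.
Qed.

Lemma laplacian_ell2 (R : realType) (psi : ell2 R) :
  (fun n => psi (n - 1) + psi (n + 1)) \in @ell2_pred R.
Proof.
apply: le_lt_trans (laplacian_l2sum psi) _.
by rewrite lte_mul_pinfty ?lee_fin//; exact: ell2_valP.
Qed.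

(* By [laplacian_is_linear], [laplacian_basis] and [laplacian_bounded] below,
   this is the bounded operator sending e_n to e_(n-1) + e_(n+1). *)
Definition laplacian (R : realType) (psi : ell2 R) : ell2 R :=
  Ell2 (laplacian_ell2 psi).

Lemma laplacian_is_linear (R : realType) : linear (@laplacian R).
Proof.
move=> a u v; apply: ell2P => n.
change ((a * (u (n - 1) : R[i]) + v (n - 1)) +
        (a * (u (n + 1) : R[i]) + v (n + 1)) =
        a * ((u (n - 1) : R[i]) + u (n + 1)) + (v (n - 1) + v (n + 1))).
by rewrite mulrDr addrACA.
Qed.

HB.instance Definition _ (R : realType) :=
  GRing.isLinear.Build R[i] (ell2 R) (ell2 R) _ (@laplacian R)
    (@laplacian_is_linear R).

Lemma laplacian_basis (R : realType) (n : int) :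
  laplacian (ell2_basis R n) = ell2_basis R (n - 1) + ell2_basis R (n + 1).
Proof.
apply: ell2P => m.
change ((m - 1 == n)%:R + (m + 1 == n)%:R =
        (m == n - 1)%:R + (m == n + 1)%:R :> R[i]).
by rewrite addrC subr_eq -(inj_eq (addIr (1 : int)) m (n - 1)) subrK.
Qed.

Lemma laplacian_bounded (R : realType) : bounded_operator (@laplacian R).
Proof.
exists 2 => psi; apply: ell2norm_dom => //.
apply: le_trans (laplacian_l2sum psi) _.
by rewrite (_ : 2 ^+ 2 = 4 :> R)// expr2; lra.
Qed.

Record bounded_seq (R : realType) := BoundedSeq {
  bounded_seq_val :> int -> R[i]^o ;
  bounded_seqP : exists M : R, forall n, normc (bounded_seq_val n) <= M }.

Lemma mul_l2sum (R : realType) (M : R) (u psi : int -> R[i]^o) :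
  (forall n, normc (u n) <= M) ->
  (l2sum (fun n => ((u n : R[i]) * psi n)%R) <= (M ^+ 2)%:E * l2sum psi)%E.
Proof.
move=> uM; have M0 : 0 <= M := le_trans (normc_ge0 _) (uM 0).
apply: l2sum_dom => [|n]; first by rewrite sqr_ge0.
by rewrite normcM exprMn ler_wpM2r ?sqr_ge0// lerXn2r// nnegrE ?normc_ge0.
Qed.

Lemma potential_ell2 (R : realType) (u : bounded_seq R) (psi : ell2 R) :
  (fun n => (u n : R[i]) * psi n) \in @ell2_pred R.
Proof.
have [M uM] := bounded_seqP u.
apply: le_lt_trans (mul_l2sum psi uM) _.
by rewrite lte_mul_pinfty ?lee_fin ?sqr_ge0//; exact: ell2_valP.
Qed.

Definition potential (R : realType) (u : bounded_seq R) (psi : ell2 R) :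
  ell2 R := Ell2 (potential_ell2 u psi).

Lemma potential_is_linear (R : realType) (u : bounded_seq R) :
  linear (potential u).
Proof.
move=> a v w; apply: ell2P => n.
change ((u n : R[i]) * (a * (v n : R[i]) + w n) =
        a * ((u n : R[i]) * v n) + (u n : R[i]) * w n).
by rewrite mulrDr mulrCA.
Qed.

HB.instance Definition _ (R : realType) (u : bounded_seq R) :=
  GRing.isLinear.Build R[i] (ell2 R) (ell2 R) _ (potential u)
    (potential_is_linear u).

Lemma potential_basis (R : realType) (u : bounded_seq R) (n : int) :
  potential u (ell2_basis R n) = (u n : R[i]) *: ell2_basis R n.
Proof.
apply: ell2P => m.
change ((u m : R[i]) * (m == n)%:R = (u n : R[i]) * (m == n)%:R).
by case: eqVneq => [->//|_]; rewrite !mulr0.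
Qed.

Lemma potential_bounded (R : realType) (u : bounded_seq R) :
  bounded_operator (potential u).
Proof.
have [M uM] := bounded_seqP u.
have M0 : 0 <= M := le_trans (normc_ge0 _) (uM 0).
by exists M => psi; apply: ell2norm_dom => //; exact: mul_l2sum.
Qed.

Definition schrodinger (R : realType) (u : bounded_seq R) : ell2 R -> ell2 R :=
  @laplacian R \+ potential u.

Record ell1 (R : realType) := Ell1 {
  ell1_val :> int -> R[i]^o ;
  ell1P : (l1sum ell1_val < +oo)%E }.

Definition ell1norm (R : realType) (u : ell1 R) : R := fine (l1sum u).

Lemma ell1_bounded (R : realType) (u : ell1 R) :
  exists M : R, forall n, normc (u n) <= M.
Proof.
exists (ell1norm u) => n.
have uf : l1sum u \is a fin_num.
  by rewrite ge0_fin_numE ?l1sum_ge0//; exact: ell1P.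
rewrite -lee_fin fineK//; apply: ereal_sup_ubound.
by exists [set n]; [split | rewrite fsbig_set1].
Qed.

Definition bounded_of_ell1 (R : realType) (u : ell1 R) : bounded_seq R :=
  BoundedSeq (ell1_bounded u).

Coercion bounded_of_ell1 : ell1 >-> bounded_seq.

(* Main.v *)
Require Import Defs.
From mathcomp Require Import all_boot all_order all_algebra.
From mathcomp Require Import all_classical all_reals all_analysis.
From mathcomp Require Import complex ring lra zify.

Set Implicit Arguments.
Unset Strict Implicit.
Unset Printing Implicit Defensive.
Import Order.TTheory GRing.Theory Num.Theory.

Local Open Scope classical_set_scope.
Local Open Scope ring_scope.
Local Open Scope complex_scope.

(** For [0 < |k| < 1] the sequence [k^|n|] solves the free eigenvalue equation
    with [lambda = k + 1/k] except at the origin, where the defect is cancelled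
    by the potential [1/k - k] supported at [0]. Since
    [lambda^2 - 4 = (1/k - k)^2], that potential has norm [Q]. Every [lambda]
    outside [[-2, 2]] is of this form, as [|k| = 1] gives [lambda = 2 Re k]. *)

Import ComplexField.Normc.

Lemma normc_norm (R : rcfType) (z : R[i]) : `|z| = (normc z)%:C.
Proof. by case: z. Qed.

(** On the unit circle the inverse is the conjugate, so the sum is twice the real part. The
    hypothesis [k^-1 - k != 0] rules out [k = 1] and [k = -1], hence the endpoints of the
    interval. *)
Lemma unit_normc_add_inv (R : realType) (k : R[i]) : normc k = 1 ->
  k^-1 - k != 0 ->
  [set t%:C | t in [set t : R | -2 < t < 2]] (k + k^-1).
Proof.
case: k => a b /= nk; have ab1 : a ^+ 2 + b ^+ 2 = 1.
  by rewrite -[LHS]sqr_sqrtr ?addr_ge0 ?sqr_ge0// nk expr1n.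
have kk : (a +i* b) * (a -i* b) = 1.
  by simpc; rewrite -!expr2 ab1 [b * a]mulrC addNr.
have k0 : a +i* b != 0 by apply: contra_eq_neq kk => ->; rewrite mul0r eq_sym oner_eq0.
have -> : (a +i* b)^-1 = a -i* b by rewrite -[RHS](mulKf k0) kk mulr1.
move=> kne; exists (a + a); last by simpc.
(* A nonzero imaginary part gives [a ^+ 2 < 1], hence the strict bounds on [a + a]. *)
have bne : b != 0 by apply: contra_neq kne => ->; simpc.
have b2 : 0 < b ^+ 2 by rewrite exprn_even_gt0.
by apply/andP; split; nra.
Qed.

(** The candidates are the two roots of [x^2 - lambda x + 1], whose discriminant has modulus
    [Q ^+ 2]. Their product is 1, so one of them lies in the open disc unless both have modulus
    1. *)
Lemma joukowsky_preimage (R : realType) (Q : R) (lambda : R[i]) :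
  0 < Q ->
  ~ [set t%:C | t in [set t : R | -2 < t < 2]] lambda ->
  `|lambda ^+ 2 - 4| = (Q ^+ 2)%:C ->
  exists k : R[i], [/\ k != 0, normc k < 1, lambda = k + k^-1 &
    normc (k^-1 - k) = Q].
Proof.
move=> Q0 lam lamQ; set s := sqrtC (lambda ^+ 2 - 4).
have ss : s ^+ 2 = lambda ^+ 2 - 4 by rewrite sqrtCK.
have two0 : (2 : R[i]) != 0 by rewrite pnatr_eq0.
have ns : normc s = Q.
  have : normc s ^+ 2 = Q ^+ 2.
    by move: lamQ; rewrite -ss normrX normc_norm -rmorphXn /= => -[].
  by move/eqP; rewrite eqrXn2 ?normc_ge0 ?ltW// => /eqP.
have root (t : R[i]) : t ^+ 2 = lambda ^+ 2 - 4 ->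
    let k := (lambda + t) / 2 in [/\ k != 0, lambda = k + k^-1 & k^-1 - k = - t].
  move=> tt k; have kk : k * ((lambda - t) / 2) = 1.
    have -> : k * ((lambda - t) / 2) = (lambda ^+ 2 - t ^+ 2) / 4.
      by rewrite /k; field.
    by rewrite tt; field.
  have k0 : k != 0 by apply: contra_eq_neq kk => ->; rewrite mul0r eq_sym oner_eq0.
  have -> : k^-1 = (lambda - t) / 2 by rewrite -[RHS](mulKf k0) kk mulr1.
  by split=> //; rewrite /k; field.
have [k0 lk dk] := root s ss.
set k := (lambda + s) / 2 in k0 lk dk.
(* The roots differ by a square root of the discriminant, of modulus [Q > 0]. *)
have kne : k^-1 - k != 0.
  by rewrite dk oppr_eq0; apply: contraTneq Q0 => s0; rewrite -ns s0 normc0 ltxx.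
have [k1|k1|k1] := ltgtP (normc k) 1.
- by exists k; split=> //; rewrite dk normcN.
- exists k^-1; split; rewrite ?invr_eq0 ?invrK//.
  + by rewrite normcV invf_lt1// (lt_trans _ k1).
  + by rewrite addrC.
  + by rewrite -opprB dk opprK.
- by case: lam; rewrite lk; exact: unit_normc_add_inv.
Qed.

Lemma esum_geometric_lty (R : realType) (r : R) : 0 <= r < 1 ->
  (\esum_(n in [set: nat]) (r ^+ n)%:E < +oo)%E.
Proof.
move=> /andP[r0 r1]; have rn n : (0 <= (r ^+ n)%:E)%E by rewrite lee_fin exprn_ge0.
rewrite -nneseries_esumT//.
(* The partial sums [(1 - r ^+ n) / (1 - r)] stay below this bound. *)
apply: (@le_lt_trans _ _ ((1 - r)^-1)%:E); last exact: ltry.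
apply: lime_le; first exact: is_cvg_nneseries.
apply: nearW => n; rewrite sumEFin lee_fin.
have /(congr1 (@^~ n))/= := geometric_seriesE 1 (negbT (lt_eqF r1)).
rewrite -exprn_geometric /series/= => ->.
by rewrite mul1r ler_pdivrMr ?subr_gt0// mulVf ?subr_eq0 ?gt_eqF// gerBl exprn_ge0.
Qed.

Lemma esum_intE (R : realType) (a : int -> \bar R) : (forall n, 0 <= a n)%E ->
  (\esum_(n in [set: int]) a n =
   \esum_(n in [set: nat]) a (Posz n) + \esum_(n in [set: nat]) a (Negz n))%E.
Proof.
move=> a0; rewrite (esumID [set n : int | 0 <= n])// !setTI; congr (_ + _)%E.
- apply: reindex_esum; split=> //.
    by move=> m n _ _ [].
  by move=> [n|n] /= n0 //; exists n.
- apply: reindex_esum; split=> //.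
    by move=> m n _ _ [].
  by move=> [n|n] /= n0 //; exists n.
Qed.

Lemma expr_absz_ell2 (R : realType) (k : R[i]) : normc k < 1 ->
  (fun n : int => k ^+ `|n|%N) \in @ell2_pred R.
Proof.
move=> k1; set r := normc k ^+ 2.
have r0 : 0 <= r by rewrite sqr_ge0.
have r1 : r < 1 by rewrite expr_lt1 ?normc_ge0.
have e n : normc (k ^+ n) ^+ 2 = r ^+ n.
  have -> : normc (k ^+ n) = normc k ^+ n.
    by elim: n => [|n IHn]; rewrite ?expr0 ?normc1// !exprS normcM IHn.
  by rewrite -!exprM mulnC.
have rlt := @esum_geometric_lty R r; rewrite r0 r1 in rlt.
rewrite /in_mem /= /ell2_pred /l2sum esum_intE; last first.
  by move=> n; rewrite lee_fin sqr_ge0.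
apply: lte_add_pinfty.
  by apply: le_lt_trans (rlt isT); apply: le_esum => n _; rewrite e.
(* [Negz n] is [-(n + 1)], so its term is [r ^+ n.+1]; the extra factor [r] is at most 1. *)
apply: le_lt_trans (rlt isT); apply: le_esum => n _.
by rewrite e lee_fin exprS ler_piMl ?exprn_ge0 ?normc_ge0 // ltW.
Qed.

Lemma l1sum_point (R : realType) (c : R[i]) (n : int) :
  l1sum (fun m => if m == n then c else 0) = (normc c)%:E.
Proof.
rewrite /l1sum (esumID [set n])// ?setTI; last first.
  by move=> m _; rewrite lee_fin normc_ge0.
rewrite esum_set1 ?lee_fin ?normc_ge0// eqxx esum1 ?adde0// => m /= mn.
by rewrite (introF eqP mn) normc0.
Qed.

Theorem mainTheorem2 (R : realType) (Q : R) (lambda : R[i]) :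
  0 < Q ->
  ~ [set t%:C | t in [set t : R | -2 < t < 2]] lambda ->
  `|lambda ^+ 2 - 4| = (Q ^+ 2)%:C ->
  exists u : ell1 R,
    ell1norm u = Q /\ ell2_eigenvalue (schrodinger u) lambda.
Proof.
move=> Q0 lam lamQ.
have [k [k0 k1 lamE kQ]] := joukowsky_preimage Q0 lam lamQ.
set w : int -> R[i]^o := fun m => if m == 0 then k^-1 - k else 0.
have w1 : l1sum w = Q%:E by rewrite l1sum_point kQ.
have wlt : (l1sum w < +oo)%E by rewrite w1 ltry.
exists (Ell1 wlt); split; first by rewrite /ell1norm w1.
(* This eigenvector takes the value 1 at the origin, so it is nonzero. *)
exists (Ell2 (expr_absz_ell2 k1)).
  apply/eqP => /(congr1 (fun v : ell2 R => v 0 : R[i])) /eqP.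
  by rewrite /= expr0 oner_eq0.
apply: ell2P => n.
change ((k ^+ absz (n - 1) + k ^+ absz (n + 1)) + (w n : R[i]) * k ^+ absz n
  = lambda * k ^+ absz n).
(* At the origin both neighbours contribute [k], and the potential turns [k + k] into [k + k^-1].
   Elsewhere the potential vanishes and one neighbour has exponent one lower, the other one
   higher. *)
rewrite lamE /w; case: n => [[|n]|n] /=.
- by rewrite expr0 !mulr1; ring.
- by rewrite subn1 addn1 /= !exprS; field.
- have -> : absz (Negz n + 1) = n by lia.
  by rewrite addn0 !exprS; field.
Qed.
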